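(* Let $R_0$ be either the ring $\mathbb{Z}_k$ of integers modulo $k$ ($k\ge2$) or the field $\mathbb{F}_p$ of prime order $p$. For $a\in R_0$, $\tau\in\mathbb{H}$ and $z\in\mathbb{C}$ put $$\psi_a(\tau):=\sum_{\substack{b\in\mathbb{Z}\\ b\equiv a\ (\mathrm{mod}\ |R_0|)}}\exp\Bigl(\frac{1}{|R_0|}\pi i\tau b^2\Bigr),\qquad \phi_a(\tau,z):=\sum_{\substack{b\in\mathbb{Z}\\ b\equiv a\ (\mathrm{mod}\ |R_0|)}}\exp\Bigl(\frac{1}{|R_0|}\pi i\tau b^2+2\pi i z b\Bigr).$$ Let $G$ be a finite permutation group on the coordinates of $R_0^n$, let $C\subseteq R_0^n$ be a $G$-code, let $H$ be a subgroup of $G$ such that $|H|$ has an inverse in $R_0$, let $t$ be the number of orbits of $H$ on the coordinates, and let $T\subseteq E:=\{1,\dots,t\}$. Then $$\mathrm{CJ}^{H}_{C\theta_H,T}\bigl(\{x_a\leftarrow\psi_a(\tau),\; y_a\leftarrow\phi_a(\tau,z)\}_{a\in R_0}\bigr)$$ is an $H$-Jacobi theta series; that is, there exist a lattice $D$ in $\mathbb{R}^n\theta_H$ and $y\in D$ such that this expression equals $\vartheta^{H}_{D,y}(\tau,z)$ for all $\tau\in\mathbb{H}$, $z\in\mathbb{C}$.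
   Context: $\mathbb{H}=\{\tau\in\mathbb{C}:\mathrm{Im}(\tau)>0\}$. A permutation group $G$ on the coordinate set $\{1,\dots,n\}$ acts on $V=R_0^n$ and on $\Gamma=\mathbb{R}^n$ on the right by $(vg)_i=v_{ig^{-1}}$. A $G$-code is an $R_0$-submodule $C\subseteq R_0^n$ with $Cg\subseteq C$ for all $g\in G$. For $H\le G$, $v\theta_H:=\frac1{|H|}\sum_{h\in H}vh$, on $\mathbb{R}^n$, and on $R_0^n$ when $|H|\cdot 1$ is a unit in $R_0$; $X\theta_H:=\{v\theta_H:v\in X\}$. Let $O_1,\dots,O_t$ be the orbits of $H$ on $\{1,\dots,n\}$ and $m_i=|O_i|$. Codes: every $u\in V\theta_H$ is uniquely $u=\sum_{i=1}^tu_i\mathbf{1}_{O_i}$ with $u_i\in R_0$, where $\mathbf 1_{O_i}\in V$ has entry $1$ on $O_i$ and $0$ elsewhere. For an $R_0$-submodule $X\subseteq V\theta_H$ and $T\subseteq E=\{1,\dots,t\}$, the complete $H$-Jacobi polynomial is $\mathrm{CJ}^H_{X,T}(\{x_a,y_a\}_{a\in R_0}):=\sum_{u\in X}\prod_{a\in R_0}x_a^{n^H_{a,T}(u)}y_a^{n^H_{a,E\setminus T}(u)}$, where $n^H_{a,S}(u)$ is the number of $i\in S$ with $u_i=a$. Lattices: every $u\in\Gamma\theta_H$ is uniquely $u=\sum_{i=1}^tu_i\overline{O_i}$ with $u_i\in\mathbb{R}$, where $\overline{O_i}\in\Gamma$ has entries $1/\sqrt{m_i}$ on $O_i$ and $0$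 elsewhere; the $H$-inner product is $\langle u,v\rangle_H:=\sum_{i=1}^tu_iv_i$. A lattice in $\Gamma\theta_H$ is the $\mathbb{Z}$-span of an $\mathbb{R}$-basis of $\Gamma\theta_H$. For a lattice $D$ in $\Gamma\theta_H$ and $y\in D$, the $H$-Jacobi theta series of $D$ with respect to $y$ is $\vartheta^H_{D,y}(\tau,z):=\sum_{x\in D}\exp\bigl(\pi i\tau\langle x,x\rangle_H+2\pi iz\langle x,y\rangle_H\bigr)$. *)

(* Defs.v *)
From HB Require Import structures.
From mathcomp Require Import all_boot all_order all_fingroup all_algebra.
From mathcomp Require Import all_classical all_reals all_analysis.
From mathcomp Require Import complex summability.
From mathcomp Require mpoly.
(* mpoly's notations are incompatible with those of mathcomp-analysis *)
Import -(notations) mpoly.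

Set Implicit Arguments.
Unset Strict Implicit.
Unset Printing Implicit Defensive.

Import Order.TTheory GRing.Theory Num.Theory.
Import numFieldNormedType.Exports.

Local Open Scope classical_set_scope.
Local Open Scope complex_scope.
Local Open Scope ring_scope.

(** Coefficient rings. [1 < k] is required because ['Z_0] and ['Z_1] are both
    the ring of integers modulo 2 in MathComp. *)
Variant coefficient_ring : finComUnitRingType -> Prop :=
  | CoefficientZ k of (1 < k)%N : coefficient_ring 'Z_k
  | CoefficientF p of prime p : coefficient_ring 'F_p.

Section PermutationAction.
Variables (K : comUnitRingType) (n : nat).
Implicit Types (v : 'rV[K]_n) (H : {group 'S_n}).

(** MathComp permutations act on the right: [(g * h) i = h (g i)], so that
    [i g^-1] is [g^-1%g i]. *)
Definition vact v (g : 'S_n) : 'rV[K]_n := \row_i v 0 (g^-1%g i).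

(** Meaningful only when [#|H|%:R] is a unit of [K]. *)
Definition theta H v : 'rV[K]_n :=
  (#|H|%:R)^-1 *: \sum_(h in H) vact v h.

End PermutationAction.

Section Orbits.
Variables (n : nat) (H : {group 'S_n}).

Definition orbits : {set {set 'I_n}} := [set orbit 'P H i | i : 'I_n]%SET.

Definition norbits : nat := #|orbits|.

Definition Orb (i : 'I_norbits) : {set 'I_n} := enum_val i.

End Orbits.

(** The coefficients [c] such that [u = \sum_i c_i e_i]; they are unique as
    soon as [u] lies in the span of [e] and [e] is linearly independent. *)
Definition coords (K : comUnitRingType) (n t : nat) (e : 'I_t -> 'rV[K]_n)
    (u : 'rV[K]_n) : 'rV[K]_t :=
  xget 0 [set c : 'rV[K]_t | u = \sum_(i < t) c 0 i *: e i].

Section Codes.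
Variables (R0 : finComUnitRingType) (n : nat).
Implicit Types (C X : {set 'rV[R0]_n}).

Definition G_code (G : {group 'S_n}) C : Prop :=
  submod_closed [in C]
  /\ forall g v, g \in G -> v \in C -> vact v g \in C.

Variable H : {group 'S_n}.

Definition indO (i : 'I_(norbits H)) : 'rV[R0]_n :=
  \row_j (j \in Orb i)%:R.

Definition ncount (a : R0) (S : {set 'I_(norbits H)}) (u : 'rV[R0]_n) : nat :=
  #|[set i in S | coords indO u 0 i == a]%SET|.

(** The variables [x_a] and [y_a] are indexed by the two summands of
    [R0 + R0], itself identified with an ordinal type by [enum_rank]. *)
Definition nvars : nat := #|{: R0 + R0}|.

Section Polynomial.
Variable A : comNzRingType.

Definition xvar (a : R0) : mpoly nvars A := mpolyX A (mnm1 (enum_rank (inl a))).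
Definition yvar (a : R0) : mpoly nvars A := mpolyX A (mnm1 (enum_rank (inr a))).

Definition CJ X (T : {set 'I_(norbits H)}) : mpoly nvars A :=
  \sum_(u in X) \prod_(a : R0)
    (xvar a ^+ ncount a T u * yvar a ^+ ncount a (~: T)%SET u).

(** Substitution [x_a <- x a], [y_a <- y a]. *)
Definition subst_xy (p : mpoly nvars A) (x y : R0 -> A) : A :=
  meval (fun i => match enum_val i with inl a => x a | inr a => y a end) p.

End Polynomial.
End Codes.

Section ComplexSeries.
Variable R : realType.

Definition expC (z : R[i]) : R[i] :=
  (expR (complex.Re z))%:C
  * (cos (complex.Im z) +i* sin (complex.Im z)).

(** The sum of [f] over [D], as the limit of the sums over finite subsets of
    [D] ordered by inclusion. It is a junk value when there is no limit, i.e.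
    when the series is not absolutely convergent. *)
Definition sumC (I : choiceType) (D : set I) (f : I -> R[i]) : R[i] :=
  @summability.sum (set_type D) R[i] (R[i])^o (fun x => f (val x)).

Definition piC : R[i] := (pi : R)%:C.

Variable R0 : finComUnitRingType.

(** For a residue class [a] in [R0] equal to ['Z_k] or ['F_p], the condition
    [b%:~R = a] says that the integer [b] is congruent to [a] modulo [#|R0|]. *)
Definition residue_class (a : R0) : set int := [set b | b%:~R = a].

Definition psi (a : R0) (tau : R[i]) : R[i] :=
  sumC (residue_class a) (fun b =>
    expC ((#|R0|%:R)^-1 * piC * 'i%C * tau * b%:~R ^+ 2)).

Definition phi (a : R0) (tau z : R[i]) : R[i] :=
  sumC (residue_class a) (fun b =>
    expC ((#|R0|%:R)^-1 * piC * 'i%C * tau * b%:~R ^+ 2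
          + 2 * piC * 'i%C * z * b%:~R)).

End ComplexSeries.

Section Lattices.
Variables (R : realType) (n : nat).

(** [D] is the Z-span of an R-basis [b] of the vector subspace [V]. *)
Definition lattice_in (V D : set 'rV[R]_n) : Prop :=
  exists d (b : d.-tuple 'rV[R]_n),
    [/\ free b, [set v | v \in <<b>>%VS] = V
      & D = [set x | exists c : 'I_d -> int,
                       x = \sum_(i < d) tnth b i *~ c i]].

Variable H : {group 'S_n}.

Definition ambient : set 'rV[R]_n := range (@theta R n H).

Definition barO (i : 'I_(norbits H)) : 'rV[R]_n :=
  \row_j (if j \in Orb i then (Num.sqrt #|Orb i|%:R)^-1 else 0).

Definition inner (u v : 'rV[R]_n) : R :=
  \sum_(i < norbits H) coords barO u 0 i * coords barO v 0 i.

Definition jacobi_theta (D : set 'rV[R]_n) (y : 'rV[R]_n) (tau z : R[i]) :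
    R[i] :=
  sumC D (fun x =>
    expC (piC R * 'i%C * tau * (inner x x)%:C
          + 2 * piC R * 'i%C * z * (inner x y)%:C)).

End Lattices.

(* Main.v *)
Require Import Defs.
From HB Require Import structures.
From mathcomp Require Import all_boot all_order all_fingroup all_algebra.
From mathcomp Require Import finmap.
From mathcomp Require Import all_classical all_reals all_analysis.
From mathcomp Require Import complex summability.
From mathcomp Require Import ring lra zify.
From mathcomp Require mpoly.
Import -(notations) mpoly.

(** Construction A. Let [s = sqrt |R0|] and let [D] be the set of the vectors
    [\sum_i (b_i / s) barO_i] whose integer coordinates [b] reduce to a word of
    [C theta_H]. The admissible [b] form a subgroup of [Z^t] which contains
    [|R0| Z^t], hence is free of rank [t], and [D] is a lattice. Take for [y]
    the vector with [b_i = 0] on [T] and [b_i = |R0|] off [T]; then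
    [<x, x> = \sum_i b_i^2 / |R0|] and [<x, y> = \sum_(i \notin T) b_i], so that
    the general term of the theta series is a product over the orbits. The
    admissible [b] are partitioned by the word [u] to which they reduce, and by
    absolute convergence the sum over the class of [u] is the product of the
    [psi_(u_i)], for [i] in [T], and of the [phi_(u_i)], for [i] off [T]. *)

Set Implicit Arguments.
Unset Strict Implicit.
Unset Printing Implicit Defensive.

Import Order.TTheory GRing.Theory Num.Theory.
Import numFieldNormedType.Exports.
Local Open Scope classical_set_scope.
Local Open Scope complex_scope.
Local Open Scope ring_scope.

#[local] Existing Instance totally_filter.

(** * Unconditional summation over arbitrary index types *)

Section UnconditionalSums.
Variable K : numFieldType.

(** A relation carries the convergence, whereas the value [summability.sum] is junk without it;
    [has_sum_sum] passes from one to the other. *)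
Definition has_sum (I : choiceType) (f : I -> K) (l : K) : Prop :=
  partial_sum f @ totally --> l.

(** Over [R[i]] the bound [M] is automatically real, because it is comparable with the empty sum. *)
Definition abs_summable (I : choiceType) (f : I -> K) : Prop :=
  exists M : K, forall A : {fset I}, \sum_(i <- A) `|f i| <= M.

Lemma partial_sumE (I : choiceType) (f : I -> K) (A : {fset I}) :
  partial_sum f A = \sum_(i <- A) f i.
Proof. by rewrite /partial_sum big_seq_fsetE. Qed.

Lemma has_sum_sum (I : choiceType) (f : I -> K) (l : K) :
  has_sum f l -> @summability.sum I K K^o f = l.
Proof. move=> fl; exact: (cvg_lim (@norm_hausdorff K K^o) fl). Qed.

Lemma ler_sum_fset (I : choiceType) (A B : {fset I}) (f : I -> K) :
  (forall i, 0 <= f i) -> (A `<=` B)%fset ->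
  \sum_(i <- A) f i <= \sum_(i <- B) f i.
Proof.
move=> f0 AB; rewrite [leRHS](big_fsetID _ (mem A)) /=.
have -> : [fset i | i in B & i \in A]%fset = A.
  apply/fsetP => i; rewrite !inE /= andbC; case iA: (i \in A) => //=.
  exact: (fsubsetP AB).
by rewrite lerDl sumr_ge0.
Qed.

Lemma le_abs_summable (I : choiceType) (f g : I -> K) :
  (forall i, `|f i| <= `|g i|) -> abs_summable g -> abs_summable f.
Proof.
by move=> fg [M gM]; exists M => A; apply: le_trans (gM A); exact: ler_sum.
Qed.

Lemma eq_has_sum (I : choiceType) (f g : I -> K) (l : K) :
  f =1 g -> has_sum f l -> has_sum g l.
Proof. by move=> /funext ->. Qed.

(** Terms outside the range of [e] vanish, so once [B] contains the preimage of [A], the sum over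
    [B] is the sum of [f] over the union of [A] and the image of [B]. *)
Lemma has_sum_reindex (I J : choiceType) (e : J -> I) (f : I -> K) (l : K) :
  injective e -> (forall i, f i != 0 -> exists j, e j = i) ->
  has_sum f l -> has_sum (f \o e) l.
Proof.
move=> e_inj e_onto fl P Pl.
have [/= A _ AP] := fl P Pl.
have finB : finite_set (e @^-1` [set` A]).
  by apply: finite_preimage; [by move=> ? ? _ _ /e_inj|exact: finite_fset].
exists (fset_set (e @^-1` [set` A])) => //= B /= AB; rewrite /nbhs /=.
have sAB : (A `<=` A `|` e @` B)%fset by exact: fsubsetUl.
have := AP (A `|` [fset e j | j in B])%fset sAB.
rewrite /= !partial_sumE.
suff -> : \sum_(i <- (A `|` [fset e j | j in B])%fset) f i = \sum_(j <- B) (f \o e) j by [].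
have -> : \sum_(j <- B) (f \o e) j = \sum_(i <- [fset e j | j in B]%fset) f i.
  by rewrite big_imfset //= => ? ? _ _ /e_inj.
symmetry; apply: big_fset_incl; first exact: fsubsetUr.
move=> i; rewrite in_fsetU => /orP[iA|->//] /negP iB.
apply/eqP/negPn/negP => /e_onto[j ji]; apply: iB.
rewrite -ji; apply/imfsetP; exists j => //=.
by apply: (fsubsetP AB); rewrite in_fset_set// inE /= ji.
Qed.

Lemma has_sum0 (I : choiceType) : has_sum (fun _ : I => 0) 0.
Proof.
apply: (@cvg_trans _ ((fun=> 0 : K) @ @totally I)); last exact: cvg_cst.
by apply: near_eq_cvg; near=> A; rewrite partial_sumE big1.
Unshelve. all: by end_near. Qed.

Lemma has_sumD (I : choiceType) (f g : I -> K) (l m : K) :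
  has_sum f l -> has_sum g m -> has_sum (fun i => f i + g i) (l + m).
Proof.
move=> fl gm; have : partial_sum f \+ partial_sum g @ totally --> l + m.
  exact: cvgD.
apply: cvg_trans; apply: near_eq_cvg; near=> A.
by rewrite /= !partial_sumE big_split.
Unshelve. all: by end_near. Qed.

Lemma has_sumM (I : choiceType) (c : K) (f : I -> K) (l : K) :
  has_sum f l -> has_sum (fun i => c * f i) (c * l).
Proof.
move=> fl; have : (fun A => c * partial_sum f A) @ totally --> c * l.
  by apply: cvgM => //; exact: cvg_cst.
apply: cvg_trans; apply: near_eq_cvg; near=> A.
by rewrite /= !partial_sumE mulr_sumr.
Unshelve. all: by end_near. Qed.

Lemma has_sum_sumr (I : choiceType) (J : finType) (P : pred J)
    (f : J -> I -> K) (l : J -> K) :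
  (forall j, P j -> has_sum (f j) (l j)) ->
  has_sum (fun i => \sum_(j | P j) f j i) (\sum_(j | P j) l j).
Proof.
move=> fl; rewrite [X in has_sum X](_ : _ = \sum_(j | P j) f j); last first.
  by apply/funext => i; rewrite fct_sumE.
elim/big_rec2: _ => [|j m g Pj gm]; first exact: has_sum0.
by apply: has_sumD => //; exact: fl.
Qed.

End UnconditionalSums.

(** * Products of series over Z, summed along cubes of Z^t *)

Section Boxes.
Variable K : numFieldType.

(** Indexing [-N, N] by an ordinal makes a cube a set of finite functions, to which
    [bigA_distr_bigA] applies. *)
Definition centered (N : nat) (j : 'I_N.*2.+1) : int := (j : nat)%:Z - N%:Z.

Lemma centered_inj N : injective (@centered N).
Proof. by move=> i j /addIr[] /val_inj. Qed.

Lemma centered_onto N (b : int) : (`|b| <= N)%N -> exists j, @centered N j = b.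
Proof.
move=> bN; have hb : (absz (b + N%:Z)%R < N.*2.+1)%N by lia.
by exists (Ordinal hb); rewrite /centered /=; lia.
Qed.

Definition centered_itv (N : nat) : {fset int} := [fset @centered N j | j : 'I_N.*2.+1]%fset.

(** Cubes are cofinal among the finite subsets of Z^t, and sums of product terms factor over
    them. *)
Definition box (t N : nat) : {fset 'rV[int]_t} :=
  [fset \row_i centered ((g : {ffun _ -> _}) i) | g in {: {ffun 'I_t -> 'I_N.*2.+1}}]%fset.

Lemma sub_centered_itv (A : {fset int}) : 
  exists N0, forall N, (N0 <= N)%N -> (A `<=` centered_itv N)%fset.
Proof.
exists (\max_(b <- A) `|b|%N) => N AN; apply/fsubsetP => b bA.
have [|j <-] := @centered_onto N b; last by apply/imfsetP; exists j.
by apply: leq_trans AN; exact: leq_bigmax_seq.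
Qed.

Lemma sub_box t (A : {fset 'rV[int]_t}) :
  exists N0, forall N, (N0 <= N)%N -> (A `<=` box t N)%fset.
Proof.
exists (\max_(b <- A) \max_i absz (b 0%R i))%N => N AN; apply/fsubsetP => b bA.
have bN i : (`|b 0%R i| <= N)%N.
  apply: leq_trans AN; apply: leq_trans (leq_bigmax_seq _ bA isT).
  exact: (@leq_bigmax _ (fun i => `|b 0%R i|%N)).
have /fin_all_exists[g gP] i := centered_onto (bN i).
apply/imfsetP; exists (finfun g) => //=.
by apply/rowP => i; rewrite mxE ffunE gP.
Qed.

Lemma big_centered_itv N (f : int -> K) :
  \sum_(b <- centered_itv N) f b = \sum_(j < N.*2.+1) f (centered j).
Proof. by rewrite big_imfset /= ?big_enum //= => ? ? _ _ /centered_inj. Qed.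

Lemma big_box t N (f : 'I_t -> int -> K) :
  \sum_(b <- box t N) \prod_i f i (b 0 i) = \prod_i \sum_(b <- centered_itv N) f i b.
Proof.
under [RHS]eq_bigr do rewrite big_centered_itv.
rewrite bigA_distr_bigA big_imfset /=; last first.
  move=> g h _ _ /rowP gh; apply/ffunP => i.
  by have := gh i; rewrite !mxE => /centered_inj.
by rewrite big_enum; apply: eq_bigr => g _; apply: eq_bigr => i _; rewrite mxE.
Qed.

Lemma centered_itv_cvg : centered_itv @ \oo --> @totally int.
Proof.
move=> P [A _ AP]; have [N0 AN] := sub_centered_itv A.
by exists N0 => // N /= /AN; exact: AP.
Qed.

Lemma box_cvg t : box t @ \oo --> @totally 'rV[int]_t.
Proof.
move=> P [A _ AP]; have [N0 AN] := sub_box A.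
by exists N0 => // N /= /AN; exact: AP.
Qed.

(** A finite sum of moduli is at most the sum over an enclosing cube, which factors into bounded
    sums. *)
Lemma abs_summable_prod t (f : 'I_t -> int -> K) :
  (forall i, abs_summable (f i)) ->
  abs_summable (fun b : 'rV[int]_t => \prod_i f i (b 0 i)).
Proof.
move=> /fin_all_exists[M fM]; exists (\prod_i M i) => A.
have [N /(_ N (leqnn _)) AN] := sub_box A.
rewrite (eq_bigr _ (fun b _ => normr_prod _ _ _)).
apply: (@le_trans _ _ (\sum_(b <- box t N) \prod_i `|f i (b 0 i)|)).
  by apply: ler_sum_fset => // b; exact: prodr_ge0.
rewrite (big_box N (fun i x => `|f i x|)).
by apply: ler_prod => i _; rewrite sumr_ge0 //=.
Qed.

(** Existence of the sum comes from absolute summability; only its value is at stake. Along cubes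
    the partial sums are products of partial sums over [-N, N], and limits are unique. *)
Lemma has_sum_prod_unique t (f : 'I_t -> int -> K) (l : 'I_t -> K) (L : K) :
  (forall i, has_sum (f i) (l i)) ->
  has_sum (fun b : 'rV[int]_t => \prod_i f i (b 0 i)) L -> L = \prod_i l i.
Proof.
move=> fl FL; have := cvg_comp _ _ (@box_cvg t) FL.
set u := (X in X @ \oo --> _) => uL.
have ul : u @ \oo --> \prod_i l i.
  rewrite [u](_ : _ = \prod_i (partial_sum (f i) \o centered_itv)).
    elim/big_rec2: _ => [|i y1 y2 _ IH]; first exact: cvg_cst.
    apply: cvgM => //; exact: (cvg_comp _ _ centered_itv_cvg (fl i)).
  apply/funext => N; rewrite /u fct_prodE /= partial_sumE big_box.
  by under [RHS]eq_bigr do rewrite partial_sumE.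
exact: (cvg_unique (@norm_hausdorff K K^o) uL ul).
Qed.

End Boxes.

(** * Absolutely convergent complex series and Gaussian bounds *)

Section ComplexSums.
Variable R : realType.

(** The limit is the supremum of the finite sums, which grow with the finite set. *)
Lemma ge0_has_sum (I : choiceType) (f : I -> R) :
  (forall i, 0 <= f i) -> abs_summable f -> exists l, has_sum f l.
Proof.
move=> f0 [M fM]; pose S := [set \sum_(i <- A) f i | A in [set: {fset I}]].
have supS : has_sup S.
  split; first by exists (\sum_(i <- fset0) f i), fset0.
  by exists M => _ [A _ <-]; apply: le_trans (fM A); apply: ler_sum => i _; exact: ler_norm.
exists (sup S); apply/(@cvgrPdist_lt _ R^o) => e e0.
have [_ [A _ <-] eA] := sup_adherent e0 supS.
exists A => //= B AB; rewrite partial_sumE.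
have := ler_sum_fset f0 AB.
have : \sum_(i <- B) f i <= sup S by apply: sup_upper_bound => //; exists B.
by move=> h1 h2; rewrite ger0_norm; lra.
Qed.

(** Write [f] as the difference of the nonnegative families [|f| + f] and [|f|]. *)
Lemma real_has_sum (I : choiceType) (f : I -> R) :
  abs_summable f -> exists l, has_sum f l.
Proof.
move=> fS; have [M fM] := fS.
have [l fl] : exists l, has_sum (fun i => `|f i|) l.
  apply: ge0_has_sum => //.
  by apply: le_abs_summable fS => i; rewrite normr_id.
have [m fm] : exists m, has_sum (fun i => `|f i| + f i) m.
  apply: ge0_has_sum => [i|]; first by have := lerNnormlW (lexx `|f i|); lra.
  apply: (@le_abs_summable _ _ _ (fun i => 2 * f i)) => [i|].
    by rewrite normrM normr_nat; apply: le_trans (ler_normD _ _) _; rewrite normr_id; lra.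
  exists (2 * M) => A; under eq_bigr do rewrite normrM normr_nat.
  by rewrite -mulr_sumr ler_pM2l.
exists (m + (-1) * l); have := has_sumD fm (@has_sumM _ _ (- 1) _ _ fl).
apply: eq_has_sum => i /=.
by rewrite mulN1r addrAC subrr add0r.
Qed.

Lemma real_complex_has_sum (I : choiceType) (f : I -> R) (l : R) :
  has_sum f l -> has_sum (fun i => (f i)%:C) l%:C.
Proof.
move=> /(@cvgrPdist_lt _ R^o) fl; apply/(@cvgrPdist_lt _ R[i]^o) => e.
(* A positive [e] of [R[i]] is real, so its real part serves as the tolerance. *)
rewrite ltcE /= => /andP[/eqP ime ree].
have := fl _ ree; apply: filterS => A; rewrite !partial_sumE => fA.
rewrite -rmorph_sum -rmorphB normc_def /= expr0n addr0 sqrtr_sqr ltcE /=.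
by rewrite ime eqxx.
Qed.

Lemma complex_has_sum (I : choiceType) (f : I -> R[i]) :
  abs_summable f -> exists l, has_sum f l.
Proof.
move=> [M fM].
have part (g : I -> R) : (forall i, (`|g i|)%:C <= `|f i|) ->
    exists l, has_sum (fun i => (g i)%:C) l.
  move=> gf; have [|l gl] := @real_has_sum I g; last first.
    by exists l%:C; exact: real_complex_has_sum.
  exists (complex.Re M) => A.
  have : (\sum_(i <- A) `|g i|)%:C <= M.
    by apply: le_trans (fM A); rewrite rmorph_sum /=; apply: ler_sum => i _; exact: gf.
  by rewrite lecE /= => /andP[].
have [a fa] := part (fun i => complex.Re (f i)) (fun i => normc_ge_Re (f i)).
have [|b fb] := part (fun i => complex.Im (f i)).
  (* The imaginary part is minus the real part after multiplication by i, which preserves the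
     modulus. *)
  move=> i; have := normc_ge_Re (f i * 'i%C).
  by rewrite ReiNIm normrN normrM [X in _ * X]normc_def /= expr0n add0r expr1n sqrtr1 mulr1.
exists (a + 'i%C * b); have := has_sumD fa (@has_sumM _ _ 'i%C _ _ fb).
apply: eq_has_sum => i /=.
by rewrite [RHS]complexE.
Qed.

Lemma expCD (x y : R[i]) : expC (x + y) = expC x * expC y.
Proof.
rewrite /expC !raddfD /= expRD cosD sinD rmorphM /=.
rewrite mulrACA; congr (_ * _); apply/eqP; rewrite eq_complex /=.
by apply/andP; split; apply/eqP; ring.
Qed.

Lemma expC0 : expC (0 : R[i]) = 1.
Proof. by rewrite /expC /= expR0 cos0 sin0 mul1r. Qed.

Lemma expC_sum (I : finType) (P : pred I) (f : I -> R[i]) :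
  expC (\sum_(i | P i) f i) = \prod_(i | P i) expC (f i).
Proof. by apply: (big_morph (@expC R)); [exact: expCD|exact: expC0]. Qed.

Lemma norm_expC (x : R[i]) : `|expC x| = (expR (complex.Re x))%:C.
Proof.
rewrite /expC normrM !normc_def /= cos2Dsin2 sqrtr1 mulr1.
by rewrite expr0n addr0 sqrtr_sqr ger0_norm ?expR_ge0.
Qed.

(** For ratio 1/2 the bound is an equality; the term in [- 2] times the [N]-th power lets the
    induction close for every ratio at most 1/2. *)
Lemma sum_centered_itv_exp N :
  \sum_(b <- centered_itv N) expR (- 1) ^+ `|b|%N <= 3 - 2 * expR (- 1) ^+ N :> R.
Proof.
have q2 : expR (- 1) <= 2^-1 :> R.
  rewrite expRN lef_pV2 ?posrE ?expR_gt0 //.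
  by have := @expR_ge1Dx R 1; lra.
have q0 := expR_gt0 (- 1 : R); move: (expR _) q0 q2 => q q0 q2.
rewrite big_centered_itv; elim: N => [|N IH].
  by rewrite big_ord_recl big_ord0 /= !expr0; lra.
rewrite (eq_bigr (fun j : 'I__ => q ^+ absz ((j : nat)%:Z - N.+1%:Z))) //.
rewrite doubleS big_ord_recl big_ord_recr /=.
rewrite [X in X + (_ + _)](_ : _ = q ^+ N.+1); last first.
  by congr (_ ^+ _); lia.
rewrite [X in _ + (_ + X)](_ : _ = q ^+ N.+1); last first.
  by congr (_ ^+ _); rewrite /bump /=; lia.
rewrite (eq_bigr (fun j : 'I_N.*2.+1 => q ^+ `|centered j|%N)); last first.
  by move=> j _; congr (_ ^+ _); rewrite /centered /= /bump /=; lia.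
apply: le_trans (_ : q ^+ N.+1 + (3 - 2 * q ^+ N + q ^+ N.+1) <= _).
  by rewrite lerD2l lerD2r.
have : q ^+ N.+1 <= q ^+ N * 2^-1 by rewrite exprSr ler_wpM2l // exprn_ge0 // ltW.
lra.
Qed.

Lemma ReM_real (c : R[i]) (x : R) :
  complex.Re (c * x%:C) = complex.Re c * x.
Proof. by case: c => a b /=; rewrite mulr0 subr0. Qed.

(** Completing the square dominates the terms by a constant times exp(-|b|), a two-sided geometric
    series whose partial sums are at most 3. *)
Lemma abs_summable_gauss (c1 c2 : R[i]) : complex.Re c2 < 0 ->
  abs_summable (fun b : int => expC (c2 * b%:~R ^+ 2 + c1 * b%:~R)).
Proof.
(* The added 1 is what leaves the factor exp(-|b|); [c] is the maximum of B|x| + Re(c2) x^2 over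
   real x. *)
move=> c2_lt0; set B := `|complex.Re c1| + 1.
pose c := B ^+ 2 / (4 * - complex.Re c2).
exists (expR c * 3)%:C => A.
have [N /(_ N (leqnn _)) AN] := sub_centered_itv A.
under eq_bigr do rewrite norm_expC.
rewrite -rmorph_sum lecR.
have le1 (b : int) : expR (complex.Re (c2 * b%:~R ^+ 2 + c1 * b%:~R)) <=
    expR c * expR (- 1) ^+ `|b|%N.
  rewrite -expRM_natr -expRD ler_expR.
  have -> : (b%:~R : R[i]) = (b%:~R : R)%:C by rewrite rmorph_int.
  rewrite raddfD /= -rmorphXn !ReM_real mulN1r natr_absz intr_norm.
  move: (b%:~R : R) => x.
  have sq : 0 <= (- complex.Re c2 * `|x| - B / 2) ^+ 2 / (- complex.Re c2).
    by rewrite divr_ge0 ?sqr_ge0 // oppr_ge0 ltW.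
  have xB : complex.Re c1 * x <= (B - 1) * `|x|.
    by rewrite /B addrK -normrM ler_norm.
  have cE : c = B ^+ 2 / (4 * - complex.Re c2) by [].
  have -> : x ^+ 2 = `|x| ^+ 2 by rewrite real_normK ?num_real.
  move: sq; rewrite (_ : _ / _ = - complex.Re c2 * `|x| ^+ 2 - B * `|x| + c).
    by lra.
  by rewrite cE; field; rewrite lt_eqF.
apply: le_trans (ler_sum _ (fun b _ => le1 b)) _.
rewrite -mulr_sumr ler_pM2l ?expR_gt0 //.
apply: le_trans (ler_sum_fset _ AN) _ => [b|]; first by rewrite exprn_ge0 // expR_ge0.
apply: le_trans (sum_centered_itv_exp N) _.
by have := exprn_ge0 N (expR_ge0 (- 1 : R)); lra.
Qed.

End ComplexSums.

(** * Bases of full-rank subgroups of Z^t *)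

Section IntegerLattices.

(* The basis is read off the Smith normal form of [M]; it has full rank because
   the determinant of [k%:M], which factors through it, is nonzero. *)
Lemma row_span_basis (m t k : nat) (M : 'M[int]_(m + t, t)) : (0 < k)%N ->
  (forall c : 'rV[int]_t, exists d, k%:R *: c = d *m M) ->
  exists2 B : 'M[int]_t, \det B != 0 &
    forall b : 'rV[int]_t, (exists d, b = d *m M) <-> (exists c, b = c *m B).
Proof.
move=> k0 kM.
have [L Lu [U Uu [d _ ME]]] := int_Smith_normal_form M.
(* [S] is the rectangular Smith form and [Dg] its upper square block; [W] extracts the first [t]
   rows, and its transpose pads with zero rows. *)
pose S := \matrix_(i < m + t, j < t) (d`_i *+ (i == j :> nat)).
pose Dg : 'M[int]_t := \matrix_(i < t, j < t) (d`_i *+ (i == j :> nat)).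
pose W : 'M[int]_(t, m + t) := \matrix_(j, i) ((j == i :> nat)%:R).
pose w := widen_ord (leq_addl m t).
have ME' : M = L *m S *m U by exact: ME.
have WS : W *m S = Dg.
  apply/matrixP => i j; rewrite !mxE (bigD1 (w i)) //= !mxE /= eqxx mul1r.
  rewrite big1 ?addr0 // => h hi; rewrite !mxE.
  by rewrite (_ : (i == h :> nat) = false) ?mul0r // eq_sym; apply/negbTE.
have WD : W^T *m Dg = S.
  apply/matrixP => i j; rewrite !mxE (bigD1 j) //= !mxE /= eqxx mulr1n.
  rewrite big1 ?addr0 => [|h hj]; last first.
    by rewrite !mxE (_ : (h == j :> nat) = false) ?mulr0n ?mulr0 //; apply/negbTE.
  rewrite (eq_sym (j : nat)); case: eqP => [->|_]; first by rewrite mul1r.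
  by rewrite mul0r mulr0n.
(* [M] and [Dg *m U] are left multiples of each other, hence have the same row span. *)
have MB : M = L *m W^T *m (Dg *m U) by rewrite ME' -WD !mulmxA.
have BM : Dg *m U = W *m invmx L *m M.
  by rewrite ME' -WS !mulmxA mulmxKV.
exists (Dg *m U) => [|b]; last first.
  split=> [[e ->]|[c ->]].
    by exists (e *m (L *m W^T)); rewrite MB !mulmxA.
  by exists (c *m (W *m invmx L)); rewrite BM !mulmxA.
have /fin_all_exists[X XP] (i : 'I_t) := kM (delta_mx 0 i).
have kXM : (k%:R)%:M = (\matrix_i X i) *m M :> 'M[int]_t.
  apply/row_matrixP => i; rewrite row_mul rowK -XP.
  by rewrite -scalemx1 linearZ /= rowE mulmx1.
have := congr1 determinant kXM; rewrite MB mulmxA det_mulmx det_scalar => kX.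
apply: contraTneq k0 => D0; have /eqP := kX.
by rewrite D0 mulr0 expf_eq0 pnatr_eq0 => /andP[_ /eqP->].
Qed.

(** The subgroup is generated by the multiples of [k] and by its finitely many members with entries
    in [0, k); together these are the rows of one integer matrix. *)
Lemma subgroup_basis (t k : nat) (P : 'rV[int]_t -> Prop) : (0 < k)%N ->
  P 0 -> (forall b c, P b -> P c -> P (b - c)) ->
  (forall b, P (k%:R *: b)) ->
  exists2 B : 'M[int]_t, \det B != 0 &
    forall b : 'rV[int]_t, P b <-> (exists c, b = c *m B).
Proof.
move=> k0 P0 PB Pk.
have PN b : P b -> P (- b) by move=> /(PB _ _ P0); rewrite sub0r.
have PD b c : P b -> P c -> P (b + c) by move=> Pb /PN /(PB _ _ Pb); rewrite opprK.
have Pn (a : nat) b : P b -> P (b *+ a).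
  by move=> Pb; elim: a => [|a IH]; rewrite ?mulr0n // mulrS; exact: PD.
have PZ (z : int) b : P b -> P (z *: b).
  case: z => a Pb; rewrite ?NegzE ?scaleNr -[Posz _]intz -pmulrn scaler_nat.
    exact: Pn.
  by apply: PN; exact: Pn.
pose T := {ffun 'I_t -> 'I_k}.
pose vec (g : T) : 'rV[int]_t := \row_i (g i : nat)%:Z.
(* Candidates outside [P] are replaced by the zero row, so that the height is independent of [P]. *)
pose A : 'M[int]_(#|T|, t) :=
  \matrix_i (if `[< P (vec (enum_val i)) >] then vec (enum_val i) else 0).
have PM (d : 'rV_(#|T| + t)) : P (d *m col_mx A (k%:R)%:M).
  rewrite -[d]hsubmxK mul_row_col; apply: (PD); last by rewrite mul_mx_scalar.
  rewrite mulmx_sum_row; apply: (big_ind P P0 PD) => i _; apply: PZ.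
  by rewrite rowK; case: asboolP.
have [b|B B0 BP] := @row_span_basis _ _ k (col_mx A (k%:R)%:M) k0.
  by exists (row_mx 0 b); rewrite mul_row_col mul0mx add0r mul_mx_scalar.
exists B => // b; rewrite -BP; split=> [Pb|[d ->]]; last exact: PM.
have kz : (k%:Z != 0) by rewrite eqz_nat -lt0n.
(* Entrywise Euclidean division by [k]: the remainder will be a row of [A], and the quotient gives
   the coefficients on the rows of [k%:M]. *)
pose q : 'rV[int]_t := \row_i divz (b 0 i) k%:Z.
have mlt i : (absz (modz (b 0%R i) k%:Z) < k)%N.
  by rewrite -ltz_nat gez0_abs ?modz_ge0 ?ltz_pmod.
pose g : T := [ffun i => Ordinal (mlt i)].
have bE : b = vec g + k%:R *: q.
  apply/rowP => i; rewrite !mxE ffunE /= gez0_abs ?modz_ge0 //.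
  by rewrite addrC [LHS](divz_eq _ k%:Z) natz mulrC.
have Pg : P (vec g).
  by have := PB _ _ Pb (Pk q); rewrite {1}bE addrK.
exists (row_mx (delta_mx 0 (enum_rank g)) q).
rewrite mul_row_col -rowE rowK enum_rankK asboolT // mul_mx_scalar.
exact: bE.
Qed.

End IntegerLattices.

(** * Orbit vectors as a basis of the invariant vectors *)

Section OrbitBases.
Variables (n : nat) (H : {group 'S_n}).
Local Notation t := (norbits H).

Lemma Orb_exists (j : 'I_n) : exists i : 'I_t, j \in Orb i.
Proof.
have jO : orbit 'P H j \in orbits H by apply/imsetP; exists j.
by exists (enum_rank_in jO (orbit 'P H j)); rewrite /Orb enum_rankK_in ?orbit_refl.
Qed.

Lemma OrbE (i : 'I_t) (j : 'I_n) : j \in Orb i -> Orb i = orbit 'P H j.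
Proof.
have /imsetP[x _ Ox] : Orb i \in orbits H by exact: enum_valP.
by rewrite Ox => jx; apply/esym/orbit_eqP.
Qed.

Lemma Orb_inj (i i' : 'I_t) (j : 'I_n) : j \in Orb i -> j \in Orb i' -> i = i'.
Proof. by move=> /OrbE Oi /OrbE Oi'; apply: enum_val_inj; rewrite -/(Orb i) Oi. Qed.

Lemma Orb_neq0 (i : 'I_t) : exists j, j \in Orb i.
Proof.
have /imsetP[x _ Ox] : Orb i \in orbits H by exact: enum_valP.
by exists x; rewrite Ox orbit_refl.
Qed.

Lemma Orb_act (i : 'I_t) (j : 'I_n) (g : 'S_n) :
  g \in H -> (g j \in Orb i) = (j \in Orb i).
Proof.
have /imsetP[x _ Ox] : Orb i \in orbits H by exact: enum_valP.
rewrite Ox => gH; rewrite -!orbit_eq_mem -apermE.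
by rewrite -[aperm j g]/('P%act j g) orbit_act.
Qed.

Variable K : comUnitRingType.

(** One family for both settings: weights 1 give [indO], and weights 1/sqrt(m_i) give [barO]. *)
Definition orbit_vec (w : 'I_t -> K) (i : 'I_t) : 'rV[K]_n :=
  \row_j (if j \in Orb i then w i else 0).

Lemma orbit_vec_sum (w c : 'I_t -> K) (i : 'I_t) (j : 'I_n) : j \in Orb i ->
  (\sum_i c i *: orbit_vec w i) 0 j = c i * w i.
Proof.
move=> ji; rewrite summxE (bigD1 i) //= !mxE ji big1 ?addr0 // => i' i'i.
rewrite !mxE ifN ?mulr0 //; apply: contraNN i'i => ji'.
by rewrite (Orb_inj ji ji').
Qed.

Lemma orbit_vec_inj (w c d : 'I_t -> K) : (forall i, w i \is a GRing.unit) ->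
  \sum_i c i *: orbit_vec w i = \sum_i d i *: orbit_vec w i -> c =1 d.
Proof.
move=> wU cd i; have [j ji] := Orb_neq0 i.
by apply: (mulIr (wU i)); rewrite -(orbit_vec_sum w c ji) cd (orbit_vec_sum w d ji).
Qed.

(** Unit weights make the coefficients unique, so the choice made by [xget] is the expected one. *)
Lemma coords_orbit_vec (w c : 'I_t -> K) (i : 'I_t) :
  (forall i, w i \is a GRing.unit) ->
  coords (orbit_vec w) (\sum_i c i *: orbit_vec w i) 0 i = c i.
Proof.
move=> wU; rewrite /coords; case: xgetP => [d _ /= /(orbit_vec_inj wU)->//|].
move=> /(_ (\row_i c i)) [] /=.
by apply: eq_bigr => i' _; rewrite mxE.
Qed.

Lemma vactE (v : 'rV[K]_n) (g : 'S_n) j : vact v g 0 j = v 0 ((g^-1)%g j).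
Proof. by rewrite mxE. Qed.

Lemma theta_vact (v : 'rV[K]_n) (g : 'S_n) : g \in H ->
  vact (theta H v) g = theta H v.
Proof.
move=> gH; apply/rowP => j; rewrite vactE !mxE !summxE; congr (_ * _).
rewrite [RHS](reindex_inj (mulIg g)) /=; apply: eq_big => [h|h _].
  by rewrite groupMr.
by rewrite !mxE invMg permM.
Qed.

(** An invariant vector is constant on each orbit; divide that constant by the weight. *)
Lemma invariant_orbit_vec (w : 'I_t -> K) (v : 'rV[K]_n) :
  (forall i, w i \is a GRing.unit) -> (forall g, g \in H -> vact v g = v) ->
  exists c : 'I_t -> K, v = \sum_i c i *: orbit_vec w i.
Proof.
move=> wU vH.
have /fin_all_exists[c cP] (i : 'I_t) :
    exists c : K, forall j, j \in Orb i -> v 0 j = c * w i.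
  have [j ji] := Orb_neq0 i; exists (v 0 j / w i) => j'.
  rewrite (OrbE ji) => /orbitP[g gH <-]; rewrite divrK //.
  by rewrite -[in LHS](vH _ gH) vactE /= apermE permK.
exists c; apply/rowP => j; have [i ji] := Orb_exists j.
by rewrite (orbit_vec_sum w c ji) (cP i).
Qed.

Lemma theta_invariant (v : 'rV[K]_n) : (#|H|%:R : K) \is a GRing.unit ->
  (forall g, g \in H -> vact v g = v) -> theta H v = v.
Proof.
move=> HU vH; rewrite /theta (eq_bigr (fun=> v)) // sumr_const.
by rewrite -scaler_nat scalerA mulVr ?scale1r.
Qed.

Lemma orbit_vec_vact (w : 'I_t -> K) i g : g \in H ->
  vact (orbit_vec w i) g = orbit_vec w i.
Proof. by move=> gH; apply/rowP => j; rewrite !mxE Orb_act ?groupV. Qed.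

Lemma vactD (u v : 'rV[K]_n) g : vact (u + v) g = vact u g + vact v g.
Proof. by apply/rowP => j; rewrite !mxE. Qed.

Lemma vactZ a (v : 'rV[K]_n) g : vact (a *: v) g = a *: vact v g.
Proof. by apply/rowP => j; rewrite !mxE. Qed.

Lemma thetaD (u v : 'rV[K]_n) : theta H (u + v) = theta H u + theta H v.
Proof.
by rewrite /theta (eq_bigr _ (fun g _ => vactD u v g)) big_split scalerDr.
Qed.

Lemma thetaZ a (v : 'rV[K]_n) : theta H (a *: v) = a *: theta H v.
Proof.
by rewrite /theta (eq_bigr _ (fun g _ => vactZ a v g)) -scaler_sumr !scalerA mulrC.
Qed.

Lemma theta_orbit_vec (w c : 'I_t -> K) : (#|H|%:R : K) \is a GRing.unit ->
  theta H (\sum_i c i *: orbit_vec w i) = \sum_i c i *: orbit_vec w i.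
Proof.
move=> HU; apply: theta_invariant => // g gH.
have v0 : vact (0 : 'rV[K]_n) g = 0 by apply/rowP => j; rewrite !mxE.
rewrite (big_morph (fun v => vact v g) (fun u v => vactD u v g) v0).
by apply: eq_bigr => i _; rewrite vactZ orbit_vec_vact.
Qed.

End OrbitBases.

(** Translation by 1 permutes the ring, so the sum of all elements absorbs [#|R0|%:R]. Hence
    multiples of [#|R0|] reduce to zero. *)
Lemma card_natr_finRing (R0 : finComUnitRingType) : #|R0|%:R = 0 :> R0.
Proof.
have : \sum_(x : R0) x = \sum_(x : R0) x + #|R0|%:R.
  by rewrite [LHS](reindex_inj (addIr 1)) big_split /= sumr_const.
by rewrite -[LHS]addr0 => /addrI.
Qed.

(** Grouping the orbits by letter, separately on [T] and off [T], turns a product over orbits into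
    powers with exponents [ncount]. *)
Lemma subst_CJ (R0 : finComUnitRingType) n (H : {group 'S_n}) (A : comNzRingType)
    (X : {set 'rV[R0]_n}) (T : {set 'I_(norbits H)}) (x y : R0 -> A) :
  subst_xy (CJ A X T) x y =
  \sum_(u in X) \prod_i (if i \in T then x else y) (coords (@indO R0 n H) u 0 i).
Proof.
rewrite /subst_xy /CJ rmorph_sum; apply: eq_bigr => u _ /=.
rewrite rmorph_prod (eq_bigr (fun a : R0 => x a ^+ ncount a T u * y a ^+ ncount a (~: T)%SET u)).
  have count (S : {set 'I_(norbits H)}) (h : R0 -> A) :
      \prod_(i in S) h (coords (@indO R0 n H) u 0 i) = \prod_a h a ^+ ncount a S u.
    rewrite (partition_big (fun i => coords (@indO R0 n H) u 0 i) xpredT) //=.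
    apply: eq_bigr => a _; rewrite (eq_bigr (fun=> h a)); last by move=> i /andP[_ /eqP->].
    by rewrite prodr_const /ncount; congr (_ ^+ _); apply: eq_card => i; rewrite !inE.
  rewrite big_split /= -!count [RHS](bigID (mem T)) /=; congr (_ * _).
    by apply: eq_bigr => i ->.
  by apply: eq_big => [i|i]; rewrite !inE // => /negbTE->.
move=> a _; rewrite rmorphM !rmorphXn /= /xvar /yvar !mevalXU.
by rewrite !enum_rankK.
Qed.

(** * Sums over subsets as sums of functions extended by zero *)

Section SumC.
Variable R : realType.

(** Extending by zero off [L] puts all series on the common index type [J], where they can be added
    and multiplied. *)
Lemma sumC_image (I J : choiceType) (v : J -> I) (L : set J) (f : I -> R[i])
    (g : J -> R[i]) (l : R[i]) :
  injective v -> (forall b, g b = if b \in L then f (v b) else 0) ->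
  has_sum g l -> sumC [set v b | b in L] f = l.
Proof.
move=> v_inj gE gl.
have eP (x : set_type [set v b | b in L]) : exists b, L b /\ v b = val x.
  by have := set_valP x => -[b Lb bx]; exists b.
pose e x := projT1 (cid (eP x)).
have [eL ev] : (forall x, L (e x)) /\ (forall x, v (e x) = val x).
  by split=> x; rewrite /e; case: cid => b /= [].
apply: has_sum_sum; have := @has_sum_reindex _ _ _ e g l.
rewrite (_ : g \o e = fun x => f (val x)); last first.
  by apply/funext => x /=; rewrite gE mem_set ?ev.
apply=> // [x y xy|b]; first by apply: val_inj; rewrite -!ev xy.
rewrite gE; case: (boolP (b \in L)) => [|_ /eqP//] /set_mem Lb _.
have vL : v b \in [set v b | b in L] by apply/mem_set; exists b.
by exists (SigSub vL); apply: v_inj; rewrite ev.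
Qed.

Lemma has_sum_gauss_residue (R0 : finComUnitRingType) (a : R0) (c1 c2 : R[i]) :
  complex.Re c2 < 0 ->
  let f b := expC (c2 * b%:~R ^+ 2 + c1 * b%:~R) in
  let g b := if b%:~R == a then f b else 0 in
  abs_summable g /\ has_sum g (sumC (residue_class a) f).
Proof.
move=> c2_lt0 f g.
have gS : abs_summable g.
  apply: le_abs_summable (abs_summable_gauss c1 c2_lt0) => b.
  by rewrite /g; case: ifP => // _; rewrite normr0.
split=> //; have [l gl] := complex_has_sum gS.
rewrite -(image_id (residue_class a)) (sumC_image (g := g) (l := l)) // => b.
rewrite /g; congr (if _ then _ else _).
by apply/eqP/idP => [ba|/set_mem //]; exact: mem_set.
Qed.

End SumC.

(** * Lattices in the ambient space from integer matrices *)

Section OrbitLattice.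
Variables (R : realType) (n : nat) (H : {group 'S_n}) (s : R).
Hypothesis s0 : s != 0.
Local Notation t := (norbits H).

Let w (i : 'I_t) : R := (Num.sqrt #|Orb i|%:R)^-1.

Lemma barO_weight_unit (i : 'I_t) : w i \is a GRing.unit.
Proof.
have [j ji] := Orb_neq0 i; rewrite unitfE invr_eq0 sqrtr_eq0 -ltNge ltr0n.
by apply/card_gt0P; exists j.
Qed.

(** Real [r] are allowed, so that the same map parametrises both the ambient space and, on integer
    [r], the lattice vectors. *)
Definition scaled_vec (r : 'rV[R]_t) : 'rV[R]_n :=
  \sum_i (r 0 i / s) *: orbit_vec w i.

Lemma scaled_vec_inj : injective scaled_vec.
Proof.
move=> r r' /(orbit_vec_inj barO_weight_unit) rr'; apply/rowP => i.
exact: (mulIf (invr_neq0 s0) (rr' i)).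
Qed.

Lemma scaled_vec_sum m (A : 'M[R]_(m, t)) (c : 'I_m -> R) :
  \sum_i c i *: scaled_vec (row i A) = scaled_vec ((\row_i c i) *m A).
Proof.
rewrite /scaled_vec; under eq_bigr do rewrite scaler_sumr.
rewrite exchange_big; apply: eq_bigr => j _ /=; rewrite mxE mulr_suml scaler_suml.
by apply: eq_bigr => i _; rewrite !mxE scalerA mulrA.
Qed.

(** Averages are invariant, hence combinations of orbit vectors; conversely [theta] fixes such
    combinations. *)
Lemma ambientP (x : 'rV[R]_n) : ambient H x <-> exists r, x = scaled_vec r.
Proof.
have HU : (#|H|%:R : R) \is a GRing.unit.
  by rewrite unitfE pnatr_eq0 -lt0n cardG_gt0.
split=> [[v _ <-]|[r ->]]; last by exists (scaled_vec r) => //; exact: theta_orbit_vec.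
have [c ->] := invariant_orbit_vec barO_weight_unit (theta_vact (H := H) v).
exists (\row_i (c i * s)); apply: eq_bigr => i _.
by rewrite mxE mulfK.
Qed.

Lemma inner_scaled_vec (r r' : 'rV[R]_t) :
  inner H (scaled_vec r) (scaled_vec r') = \sum_i (r 0 i / s) * (r' 0 i / s).
Proof.
apply: eq_bigr => i _.
by rewrite !(coords_orbit_vec (w := w) _ _ barO_weight_unit).
Qed.

(** The nonzero determinant makes [B] invertible over the reals, so the injective linear map
    [scaled_vec] sends its rows to a basis of the ambient space. *)
Lemma lattice_scaled_vec (B : 'M[int]_t) : \det B != 0 ->
  lattice_in (ambient H)
    [set scaled_vec (map_mx intr b) | b in [set b | exists c, b = c *m B]].
Proof.
move=> B0; pose BR : 'M[R]_t := map_mx intr B.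
have BU : BR \in unitmx by rewrite unitmxE det_map_mx unitfE intr_eq0.
pose b := [tuple scaled_vec (row i BR) | i < t].
have nthE (i : 'I_t) : b`_i = scaled_vec (row i BR).
  by rewrite -[RHS](tnth_mktuple (fun i => scaled_vec (row i BR))) (tnth_nth 0).
exists t, b; split.
- apply/freeP => c; under eq_bigr do rewrite nthE.
  rewrite scaled_vec_sum => c0 i.
  have : (\row_i c i) *m BR = 0.
    apply: scaled_vec_inj; rewrite c0 /scaled_vec big1 // => j _.
    by rewrite mxE mul0r scale0r.
  by move=> /(congr1 (mulmx^~ (invmx BR))); rewrite mulmxK // mul0mx => /rowP/(_ i); rewrite !mxE.
- apply/seteqP; split=> x.
    move=> /(@coord_span _ _ _ b) ->; apply/ambientP; under eq_bigr do rewrite nthE.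
    by rewrite scaled_vec_sum; eexists.
  move=> /ambientP[r ->]; rewrite -[r](mulmxKV BU).
  set c := r *m _; have -> : c = \row_i c 0 i by apply/rowP => i; rewrite mxE.
  rewrite -scaled_vec_sum; apply: memv_suml => i _; apply: memvZ.
  by apply: memv_span; rewrite -nthE mem_nth ?size_tuple.
- have cE (c : 'I_t -> int) :
      \sum_(i < t) tnth [tuple scaled_vec (row i BR) | i < t] i *~ c i =
      scaled_vec (map_mx intr ((\row_i c i) *m B)).
    rewrite map_mxM /= (_ : map_mx _ _ = \row_i (c i)%:~R); last first.
      by apply/rowP => i; rewrite !mxE.
    rewrite -scaled_vec_sum; apply: eq_bigr => i _.
    by rewrite tnth_mktuple scaler_int.
  apply/seteqP; split=> x /=.
    move=> [_ [c ->] <-]; exists (c 0); rewrite cE; congr (scaled_vec (map_mx _ (_ *m _))).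
    by apply/rowP => i; rewrite mxE.
  by move=> [c ->]; rewrite cE; eexists; [eexists|].
Qed.

End OrbitLattice.

(** * Integer vectors reducing to words of the averaged code *)

Section CodeLattice.
Variables (R0 : finComUnitRingType) (n : nat) (H : {group 'S_n}).
Local Notation t := (norbits H).

Definition residue_vec (b : 'rV[int]_t) : 'rV[R0]_n :=
  \sum_i (b 0 i)%:~R *: indO R0 i.

Lemma indOE : @indO R0 n H = orbit_vec (fun=> 1).
Proof. by apply/funext => i; apply/rowP => j; rewrite !mxE; case: ifP. Qed.

Lemma coords_residue_vec (b : 'rV[int]_t) i :
  coords (@indO R0 n H) (residue_vec b) 0 i = (b 0 i)%:~R.
Proof.
by rewrite /residue_vec indOE (coords_orbit_vec (w := fun=> 1)) // => ?; exact: unitr1.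
Qed.

Lemma residue_vecB (b c : 'rV[int]_t) :
  residue_vec (b - c) = residue_vec b - residue_vec c.
Proof.
rewrite /residue_vec -sumrB; apply: eq_bigr => i _.
by rewrite !mxE rmorphB /= scalerBl.
Qed.

(** An averaged word is constant on orbits, hence determined by its orbit coordinates. *)
Lemma residue_vec_coords (C : {set 'rV[R0]_n}) (u : 'rV[R0]_n) (b : 'rV[int]_t) :
  u \in theta H @: C ->
  (forall i, (b 0 i)%:~R = coords (@indO R0 n H) u 0 i) -> residue_vec b = u.
Proof.
move=> /imsetP[v _ ->] bu.
have U1 (i : 'I_t) : (1 : R0) \is a GRing.unit by exact: unitr1.
have [c cE] := invariant_orbit_vec (w := fun=> 1) U1 (theta_vact (H := H) v).
rewrite /residue_vec cE indOE; apply: eq_bigr => i _.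
by rewrite bu cE indOE (coords_orbit_vec (w := fun=> 1)).
Qed.

(** By linearity of [theta] the admissible vectors form a subgroup, and it contains the multiples of
    [#|R0|], which reduce to the zero word. *)
Lemma code_lattice_basis (C : {set 'rV[R0]_n}) : submod_closed [in C] ->
  exists2 B : 'M[int]_t, \det B != 0 &
    forall b, residue_vec b \in theta H @: C <-> exists c, b = c *m B.
Proof.
move=> [C0 CL]; have k0 : (0 < #|R0|)%N by apply/card_gt0P; exists 0.
apply: (subgroup_basis (P := fun b => residue_vec b \in theta H @: C) k0).
- apply/imsetP; exists 0 => //; rewrite -[0 in RHS](scale0r 0) thetaZ scale0r.
  by rewrite /residue_vec big1 // => i _; rewrite mxE scale0r.
- move=> b c /imsetP[u uC bu] /imsetP[v vC cv]; rewrite residue_vecB bu cv.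
  apply/imsetP; exists ((-1) *: v + u); first exact: CL.
  by rewrite thetaD thetaZ scaleN1r addrC.
move=> b; apply/imsetP; exists 0 => //; rewrite -[0 in RHS](scale0r 0) thetaZ scale0r.
rewrite /residue_vec big1 // => i _.
by rewrite mxE rmorphM /= natz -pmulrn card_natr_finRing mul0r scale0r.
Qed.

End CodeLattice.

(** * The theta identity for the Construction A lattice *)

Theorem theorem6p2 (R : realType) (R0 : finComUnitRingType)
    (hR0 : coefficient_ring R0) (n : nat) (G : {group 'S_n})
    (C : {set 'rV[R0]_n}) (hC : G_code G C)
    (H : {group 'S_n}) (hHG : H \subset G)
    (hH : (#|H|%:R : R0) \is a GRing.unit)
    (T : {set 'I_(norbits H)}) :
  exists (D : set 'rV[R]_n) (y : 'rV[R]_n),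
    [/\ lattice_in (ambient H) D, D y
      & forall tau z : R[i], 0 < complex.Im tau ->
          subst_xy (CJ R[i] (theta H @: C) T)
            (fun a => psi a tau) (fun a => phi a tau z)
          = jacobi_theta H D y tau z].
Proof.
have [[C_closed _] k0] : G_code G C /\ (0 < #|R0|)%N.
  by split=> //; apply/card_gt0P; exists 0.
pose k : R := #|R0|%:R; pose s := Num.sqrt k.
have kgt0 : 0 < k by rewrite ltr0n.
have s0 : s != 0 by rewrite sqrtr_eq0 -ltNge.
have ss : s * s = k by rewrite -expr2 sqr_sqrtr // ltW.
pose X := theta H @: C.
pose L := [set b : 'rV[int]_(norbits H) | residue_vec R0 b \in X].
pose vec (b : 'rV[int]_(norbits H)) : 'rV[R]_n := scaled_vec s (map_mx intr b).
pose y0 : 'rV[int]_(norbits H) := \row_i (if i \in T then 0 else #|R0|%:Z).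
have vec_inj : injective vec.
  move=> b c /(scaled_vec_inj s0)/rowP bc; apply/rowP => i.
  by have := bc i; rewrite !mxE => /intr_inj.
exists [set vec b | b in L], (vec y0); split.
- have [B B0 BP] := code_lattice_basis H C_closed.
  rewrite (_ : L = [set b | exists c, b = c *m B]); first exact: lattice_scaled_vec.
  by apply/seteqP; split=> b /BP.
(* The entries of [y0] are 0 or [#|R0|], so it reduces to the zero word. *)
- exists y0 => //; have [C0 _] := C_closed; apply/imsetP; exists 0 => //.
  rewrite -[0 in RHS](scale0r 0) thetaZ scale0r /residue_vec big1 // => i _.
  by rewrite mxE; case: ifP; rewrite ?scale0r // -pmulrn card_natr_finRing scale0r.
move=> tau z tau_gt0.
pose c2 : R[i] := (#|R0|%:R)^-1 * piC R * 'i%C * tau.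
(* [psi] is the Gaussian series without linear term, which lets orbits in [T] and off [T] be treated
   uniformly. *)
pose c1 i : R[i] := if i \in T then 0 else 2 * piC R * 'i%C * z.
have kE : (#|R0|%:R : R[i])^-1 = (k^-1)%:C by rewrite fmorphV rmorph_nat.
(* This real part is -pi Im(tau) / |R0|. *)
have c2_lt0 : complex.Re c2 < 0.
  rewrite /c2 kE /piC -rmorphM -mulrA mulrC ReM_real mulrC ['i%C * _]mulrC ReiNIm.
  by rewrite mulrN oppr_lt0 !mulr_gt0 ?invr_gt0 ?pi_gt0.
pose f i (b : int) := expC (c2 * b%:~R ^+ 2 + c1 i * b%:~R).
pose g i (a : R0) (b : int) := if b%:~R == a then f i b else 0.
pose l i (a : R0) := (if i \in T then psi a tau else phi a tau z).
have gl i (a : R0) : abs_summable (g i a) /\ has_sum (g i a) (l i a).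
  have [gS gl] := has_sum_gauss_residue a (c1 i) c2_lt0.
  suff <- : sumC (residue_class a) (f i) = l i a by [].
  rewrite /l /psi /phi /f /c1; case: ifP => _ //.
  by congr sumC; apply/funext => b; rewrite mul0r addr0.
rewrite subst_CJ (eq_bigr (fun u : 'rV[R0]_n => \prod_i l i (coords (@indO R0 n H) u 0 i))); last first.
  by move=> u _; apply: eq_bigr => i _; rewrite /l; case: ifP.
(* At each [b] at most one word contributes to [F]: the reduction of [b]. So [F] will be the theta
   term on [L] and zero off [L]. *)
pose F (b : 'rV[int]_(norbits H)) : R[i] :=
  \sum_(u in X) \prod_i g i (coords (@indO R0 n H) u 0 i) (b 0 i).
have Fl : has_sum F (\sum_(u in X) \prod_i l i (coords (@indO R0 n H) u 0 i)).
  apply: has_sum_sumr => u _.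
  (* Absolute summability gives a sum, and the factorisation along cubes identifies it. *)
  have [l' ul'] := complex_has_sum (abs_summable_prod (fun i => (gl i (coords (@indO R0 n H) u 0 i)).1)).
  by rewrite -(has_sum_prod_unique (fun i => (gl i (coords (@indO R0 n H) u 0 i)).2) ul').
rewrite /jacobi_theta; symmetry; apply: sumC_image vec_inj _ Fl => b.
(* If [u] is not the reduction of [b], some entry of [b] misses its residue class and kills the
   product. *)
have Fu u : u \in X -> u != residue_vec R0 b ->
    \prod_i g i (coords (@indO R0 n H) u 0 i) (b 0 i) = 0.
  move=> uX ub; apply/eqP; apply: contraNT ub => /prodf_neq0 gb.
  apply/eqP/esym/(residue_vec_coords uX) => i.
  by apply/eqP; apply: contraNT (gb i isT); rewrite /g => /negbTE ->.
case: ifPn => [/set_mem bX|bX]; last first.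
  apply: big1 => u uX; apply: Fu => //; apply: contraNneq bX => ub.
  by apply/mem_set; rewrite /L /= -ub.
rewrite /F (bigD1 (residue_vec R0 b)) //= [X in _ + X]big1 ?addr0; last first.
  by move=> u /andP[]; exact: Fu.
rewrite (eq_bigr (fun i => f i (b 0 i))); last first.
  by move=> i _; rewrite /g coords_residue_vec eqxx.
rewrite -expC_sum; congr expC.
rewrite !inner_scaled_vec // !rmorph_sum !mulr_sumr -big_split /=.
apply: eq_bigr => i _; rewrite !mxE /c2 kE.
have intE (x : int) : x%:~R = (x%:~R : R)%:C by rewrite rmorph_int.
rewrite !intE /c1.
(* Since [s * s = k], the norm contributes b_i^2 / k, while the entry [#|R0|] of [y0] off [T]
   cancels the scaling and leaves b_i. *)
have -> : (b 0 i)%:~R / s * ((b 0 i)%:~R / s) = k^-1 * (b 0 i)%:~R ^+ 2 :> R.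
  by rewrite -ss; field.
have -> : (b 0 i)%:~R / s * ((if i \in T then 0 else #|R0|%:Z)%:~R / s) =
    (if i \in T then 0 else (b 0 i)%:~R) :> R.
  by case: ifP => _; rewrite ?mul0r ?mulr0 // -pmulrn -/k -ss; field.
move: (b 0 i)%:~R k^-1 => x q.
have -> : (q * x ^+ 2)%:C = q%:C * x%:C ^+ 2 by rewrite -rmorphXn -rmorphM.
by case: ifP => _; [rewrite rmorph0|]; ring.
Qed.
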